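(* Let $n \geq 1$ be an integer and $0 \leq \epsilon < 1$ with $\epsilon/(1-\epsilon)^2 \leq 1/(64 n)$. If $(X_1, Z_1), \ldots, (X_m, Z_m)$ are $m$ qubits in a $2^n$-dimensional complex Hilbert space such that $\|[S_i, T_j]\| \leq \epsilon$ for all $i \neq j$ in $\{1,\ldots,m\}$ and all $S, T \in \{X, Z\}$, then $m \leq n$.
   Context: A reflection is a Hermitian operator that squares to the identity. A qubit in a Hilbert space $\mathcal H$ is a pair $(X, Z)$ of anti-commuting reflections on $\mathcal H$, i.e. $XZ + ZX = 0$. $[A,B] = AB - BA$ and $\|\cdot\|$ is the operator norm. ''$S_i$ for $S \in \{X,Z\}$'' means $X_i$ or $Z_i$. *)

(* Defs.v *)
From mathcomp Require Import all_boot all_order all_algebra.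
From mathcomp Require Import complex.
From mathcomp Require Import classical_sets reals.

Set Implicit Arguments.
Unset Strict Implicit.
Unset Printing Implicit Defensive.

Import Order.TTheory GRing.Theory Num.Theory.
Local Open Scope ring_scope.
Local Open Scope complex_scope.
Local Open Scope classical_set_scope.

(* A finite-dimensional complex Hilbert space is a [vectType R[i]] with a
   positive-definite Hermitian form [dot]; it is linear in its first argument
   and conjugate-linear in the second. *)
Section Hilbert.
Variables (R : realType) (H : vectType R[i]) (dot : {dot H for Num.conj}).

Definition hnorm (v : H) : R := Num.sqrt (complex.Re (dot v v)).

(* [sup] is the real-valued supremum; in finite dimension the set below is
   nonempty and bounded, so this is the genuine least upper bound. *)
Definition opnorm (A : 'End(H)) : R :=
  sup [set hnorm (A v) | v in [set v : H | hnorm v <= 1]].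

Definition hermitian_op (A : 'End(H)) : Prop :=
  forall u v : H, dot (A u) v = dot u (A v).

Definition reflection (A : 'End(H)) : Prop :=
  hermitian_op A /\ (A \o A)%VF = \1%VF.

Definition qubit (X Z : 'End(H)) : Prop :=
  [/\ reflection X, reflection Z & (X \o Z)%VF + (Z \o X)%VF = 0].

End Hilbert.

Definition commutator (K : fieldType) (V : vectType K) (A B : 'End(V)) : 'End(V) :=
  (A \o B)%VF - (B \o A)%VF.

(* Main.v *)
(* One makes the qubits commute exactly one at a time.  If (X, Z) is the current
   qubit, averaging an operator S over conjugation by X and then by Z gives an
   operator E(S) commuting with X and Z.  With every commutator bounded by 2e,
   the error S - E(S) has norm O(e), but E(S)E(T) - E(ST) is quadratic in such
   errors and has norm at most 2e^2.  Hence E(X'), E(Z')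
   satisfy the qubit relations up to O(e^2); rounding them to an exact qubit,
   by taking the sign of a Hermitian operator, costs O(e^2) and stays inside the
   commutant of whatever commutes with E(X') and E(Z').  So e only grows
   to e + 30 e^2, i.e. 1/e drops by at most 30, and n rounds fit in the budget
   1/e >= 128 n.  Finally n+1 exactly commuting qubits give an idempotent
   prod (1 + Z_i)/2 of trace dim/2^(n+1), which must be an integer. *)

Require Import Defs.
From mathcomp Require Import all_boot all_order all_algebra.
From mathcomp Require Import complex.
From mathcomp Require Import classical_sets reals.
From mathcomp Require Import ring lra zify.

Import Order.TTheory GRing.Theory Num.Theory.
Import VectorInternalTheory.
Local Open Scope ring_scope.

Set Implicit Arguments.
Unset Strict Implicit.
Unset Printing Implicit Defensive.

(** * Hermitian matrices *)

Section Adjoint.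
Variable C : numClosedFieldType.
Local Open Scope sesquilinear_scope.

Definition adjmx m n (A : 'M[C]_(m, n)) : 'M[C]_(n, m) := A^t*.

Lemma adjmxE m n (A : 'M[C]_(m, n)) i j : adjmx A i j = (A j i)^*.
Proof. by rewrite !mxE. Qed.

Lemma adjmxM m n p (A : 'M[C]_(m, n)) (B : 'M[C]_(n, p)) :
  adjmx (A *m B) = adjmx B *m adjmx A.
Proof. by rewrite /adjmx trmx_mul map_mxM. Qed.

Lemma adjmxK m n (A : 'M[C]_(m, n)) : adjmx (adjmx A) = A.
Proof. exact: trmxCK. Qed.

Lemma adjmxD m n (A B : 'M[C]_(m, n)) : adjmx (A + B) = adjmx A + adjmx B.
Proof. by rewrite /adjmx linearD /= map_mxD. Qed.

Lemma adjmxN m n (A : 'M[C]_(m, n)) : adjmx (- A) = - adjmx A.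
Proof. by rewrite /adjmx linearN /= map_mxN. Qed.

Lemma adjmxZ m n (a : C) (A : 'M[C]_(m, n)) : adjmx (a *: A) = a^* *: adjmx A.
Proof. by rewrite /adjmx linearZ /= map_mxZ. Qed.

Lemma adjmx_diag n (d : 'rV[C]_n) : (forall i, d 0 i \is Num.real) ->
  adjmx (diag_mx d) = diag_mx d.
Proof.
move=> dr; rewrite /adjmx tr_diag_mx map_diag_mx; congr diag_mx.
by apply/rowP => i; rewrite mxE; apply: conj_Creal.
Qed.

Lemma dotmx_adjE n (u v : 'rV[C]_n) : dotmx u v = (u *m adjmx v) 0 0.
Proof. exact: dotmxE. Qed.

Lemma dotmx_mull n (u v : 'rV[C]_n) (A : 'M[C]_n) :
  dotmx (u *m A) v = dotmx u (v *m adjmx A).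
Proof. by rewrite !dotmx_adjE adjmxM adjmxK mulmxA. Qed.

Lemma dotmx_sum n (u : 'rV[C]_n) : dotmx u u = \sum_i `|u 0 i| ^+ 2.
Proof.
rewrite dotmx_adjE mxE; apply: eq_bigr => i _.
by rewrite adjmxE normCK.
Qed.

Lemma dotmx_delta_r n (u : 'rV[C]_n) j : dotmx u (delta_mx 0 j) = u 0 j.
Proof. by rewrite dotmx_adjE /adjmx trmx_delta map_delta_mx -colE mxE. Qed.

Lemma dotmx_extensional n (A B : 'M[C]_n) :
  (forall u v : 'rV[C]_n, dotmx (u *m A) v = dotmx (u *m B) v) -> A = B.
Proof.
move=> AB; apply/row_matrixP => i; apply/rowP => j.
by rewrite -dotmx_delta_r rowE AB dotmx_delta_r -rowE.
Qed.

Lemma hermitian_spectral n (A : 'M[C]_n) : adjmx A = A ->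
  [/\ spectralmx A *m adjmx (spectralmx A) = 1%:M,
      adjmx (spectralmx A) *m spectralmx A = 1%:M,
      forall i, spectral_diag A 0 i \is Num.real &
      A = adjmx (spectralmx A) *m diag_mx (spectral_diag A) *m spectralmx A].
Proof.
move=> Ah; have Aherm : A \is hermsymmx.
  by apply/is_hermitianmxP; rewrite expr0 scale1r -[LHS]Ah.
have /orthomx_spectralP AE := hermitian_normalmx Aherm.
have Pu := spectral_unitarymx A; split.
- exact/unitarymxP.
- exact/mulmx1C/unitarymxP.
- move=> i; have /mxOverP := hermitian_spectral_diag_real Aherm; exact.
- by rewrite {1}AE invmx_unitary.
Qed.

Lemma spectral_eigenvalue n (P : 'M[C]_n) d i :
  P *m adjmx P = 1%:M ->
  (delta_mx 0 i *m P : 'rV_n) *m (adjmx P *m diag_mx d *m P) =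
  d 0 i *: (delta_mx 0 i *m P).
Proof.
move=> PP; rewrite !mulmxA -(mulmxA _ P) PP mulmx1 -rowE row_diag_mx.
by rewrite -scalemxAl.
Qed.

(** The norm is taken in [C] itself, so all the bounds below are elements of [C] compared in its
    partial order. *)
Definition rnorm n (u : 'rV[C]_n) : C := sqrtC (dotmx u u).

Lemma rnorm_ge0 n (u : 'rV[C]_n) : 0 <= rnorm u.
Proof. exact: sqrt_dnorm_ge0. Qed.

Lemma rnorm_triangle n (u v : 'rV[C]_n) : rnorm (u + v) <= rnorm u + rnorm v.
Proof. by rewrite triangle_lerif. Qed.

Lemma rnormZ n (a : C) (u : 'rV[C]_n) : rnorm (a *: u) = `|a| * rnorm u.
Proof.
rewrite /rnorm dnormZ sqrtCM ?nnegrE ?exprn_ge0 ?normr_ge0 ?dnorm_ge0 //.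
by rewrite sqrCK ?normr_ge0.
Qed.

Lemma rnormN n (u : 'rV[C]_n) : rnorm (- u) = rnorm u.
Proof. by rewrite -scaleN1r rnormZ normrN1 mul1r. Qed.

Lemma dotmx_isometry n (P : 'M[C]_n) (u : 'rV[C]_n) :
  P *m adjmx P = 1%:M -> dotmx (u *m P) (u *m P) = dotmx u u.
Proof. by move=> PP; rewrite dotmx_mull -mulmxA PP mulmx1. Qed.

Lemma dotmx_delta n (i : 'I_n) : dotmx (delta_mx 0 i) (delta_mx 0 i) = 1 :> C.
Proof.
rewrite dotmx_sum (bigD1 i) //= big1 ?addr0 => [|j /negPf ji].
  by rewrite !mxE !eqxx normr1 expr1n.
by rewrite !mxE ji andbF normr0 expr0n.
Qed.

(** Positivity tested on eigenvectors makes every eigenvalue positive, so square roots of the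
    eigenvalues give [T]. Applied to a Gram matrix, this produces an orthonormal basis. *)
Lemma gram_factorization n (G : 'M[C]_n) : adjmx G = G ->
  (forall x : 'rV[C]_n, x != 0 -> 0 < dotmx (x *m G) x) ->
  exists2 T, T \in unitmx & G = T *m adjmx T.
Proof.
move=> /hermitian_spectral[]; set P := spectralmx G; set d := spectral_diag G.
move=> PP _ _ GE Gpos.
have d_gt0 i : 0 < d 0 i.
  have := Gpos (delta_mx 0 i *m P).
  rewrite GE spectral_eigenvalue // linearZl_LR /= dotmx_isometry // dotmx_delta.
  rewrite mulr1; apply; apply/eqP => /(congr1 (fun x => dotmx x x)).
  by rewrite dotmx_isometry // dotmx_delta linear0l => /eqP; rewrite oner_eq0.
pose s : 'rV[C]_n := \row_i sqrtC (d 0 i).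
have [_ Punit] := mulmx1_unit PP.
exists (adjmx P *m diag_mx s).
  rewrite unitmx_mul Punit unitmxE det_diag unitfE /=.
  by apply/prodf_neq0 => i _; rewrite mxE sqrtC_eq0 gt_eqF.
rewrite adjmxM adjmxK adjmx_diag => [|i].
  rewrite GE !mulmxA -(mulmxA _ (diag_mx s) (diag_mx s)) mulmx_diag.
  by congr (_ *m diag_mx _ *m _); apply/rowP => i; rewrite !mxE -expr2 sqrtCK.
by rewrite mxE ger0_real // sqrtC_ge0 ltW.
Qed.

End Adjoint.

(** * Twirling and the sign of a Hermitian matrix *)

Section Twirl.
Variables (C : numClosedFieldType) (n : nat).
Implicit Types A B P S T : 'M[C]_n.

(** For an involution [P] this is the projection onto the commutant of [P], averaging over
    conjugation by 1 and [P]. *)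
Definition twirl P S := 2^-1 *: (S + P * S * P).

Lemma matrix_halfD S : 2^-1 *: (S + S) = S.
Proof. by rewrite -mulr2n -scaler_nat scalerA mulVf ?pnatr_eq0 // scale1r. Qed.

Lemma sub_twirl P S : S - twirl P S = 2^-1 *: (S - P * S * P).
Proof. by rewrite -{1}(matrix_halfD S) -scalerBr opprD addrACA subrr add0r. Qed.

Lemma twirlB P S T : twirl P (S - T) = twirl P S - twirl P T.
Proof. by rewrite /twirl mulrBr mulrBl addrACA -opprD scalerBr. Qed.

Lemma twirlD P S T : twirl P (S + T) = twirl P S + twirl P T.
Proof. by rewrite /twirl mulrDr mulrDl addrACA scalerDr. Qed.

Lemma twirl0 P : twirl P 0 = 0.
Proof. by rewrite /twirl mulr0 mul0r addr0 scaler0. Qed.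

Lemma twirl1 P : P * P = 1 -> twirl P 1 = 1.
Proof. by move=> PP; rewrite /twirl mulr1 PP matrix_halfD. Qed.

Lemma adjmx_twirl P S : adjmx P = P -> adjmx S = S -> adjmx (twirl P S) = twirl P S.
Proof.
move=> Ph Sh; rewrite /twirl adjmxZ conj_Creal ?rpredV ?realn //.
by rewrite adjmxD !adjmxM Ph Sh mulmxA.
Qed.

Lemma mulmx_scalel (a : C) S T : (a *: S) * T = a *: (S * T).
Proof. exact/esym/scalemxAl. Qed.

Lemma mulmx_scaler (a : C) S T : S * (a *: T) = a *: (S * T).
Proof. exact/esym/scalemxAr. Qed.

Lemma commr_scalemx B (a : C) S : GRing.comm B S -> GRing.comm B (a *: S).
Proof. by move=> BS; rewrite /GRing.comm mulmx_scaler mulmx_scalel; congr (_ *: _). Qed.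

Lemma twirl_comm P S : P * P = 1 -> GRing.comm P (twirl P S).
Proof.
move=> PP; apply: commr_scalemx.
by rewrite /GRing.comm mulrDr mulrDl !mulrA PP mul1r -[_ * P * P]mulrA PP mulr1 addrC.
Qed.

Lemma comm_twirl B P S : GRing.comm B P -> GRing.comm B S -> GRing.comm B (twirl P S).
Proof.
by move=> BP BS; apply: commr_scalemx; apply: commrD => //; do !apply: commrM.
Qed.

(** Moving [B] through [P * S * P] changes the sign twice. Hence a twirl by Z keeps the commutation
    with X gained by an earlier twirl. *)
Lemma anticomm_twirl B P S : B * P = - (P * B) -> GRing.comm B S ->
  GRing.comm B (twirl P S).
Proof.
move=> BP BS; apply: commr_scalemx; apply: commrD => //.
rewrite /GRing.comm !mulrA BP mulNr -(mulrA P B S) BS mulrA mulNr.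
by rewrite -(mulrA _ B P) BP mulrN opprK !mulrA.
Qed.

(** Conjugation by [P] is multiplicative, so with s and t the conjugates of S and T both sides equal
    -(S - s)(T - t)/4. This is the source of all the quadratic errors. *)
Lemma twirlM_defect P S T : P * P = 1 ->
  twirl P S * twirl P T - twirl P (S * T) = - ((S - twirl P S) * (T - twirl P T)).
Proof.
move=> PP; set s := P * S * P; set t := P * T * P.
have st : s * t = P * (S * T) * P.
  by rewrite /s /t !mulrA -[_ * P * P]mulrA PP mulr1.
rewrite !sub_twirl -/s -/t /twirl -/s -/t -st !mulmx_scalel !mulmx_scaler.
rewrite !mulrDl !mulrDr !mulNr !mulrN.
move: (S * T) (s * t) (S * t) (s * T) => a b c d.
apply/matrixP => i j; rewrite !mxE.
by move: (a i j) (b i j) (c i j) (d i j) => {}a {}b {}c {}d; field.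
Qed.

End Twirl.

Section MatrixSign.
Variables (C : numClosedFieldType) (n : nat).
Implicit Types A B P S T : 'M[C]_n.

(** Functional calculus for the sign function; the kernel of [A] is sent to 0, so an involution
    results only when [A] is invertible. *)
Definition sgnmx A : 'M[C]_n :=
  adjmx (spectralmx A) *m diag_mx (map_mx Num.sg (spectral_diag A)) *m spectralmx A.

Lemma real_sgN (x : C) : x \is Num.real -> Num.sg (- x) = - Num.sg x.
Proof.
move=> xr; case: (real_ltgt0P xr) => [x0|x0|->]; last by rewrite oppr0 sgr0 oppr0.
  by rewrite (gtr0_sg x0) ltr0_sg // oppr_lt0.
by rewrite (ltr0_sg x0) gtr0_sg ?oppr_gt0 // opprK.
Qed.

Lemma adjmx_sgnmx A : adjmx A = A -> adjmx (sgnmx A) = sgnmx A.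
Proof.
move=> Ah; rewrite /sgnmx !adjmxM adjmxK adjmx_diag ?mulmxA // => i.
rewrite mxE /Num.sg; case: eqP => // _.
by case: ifP; rewrite ?rpredN ?real1.
Qed.

(** [b] selects commutation ([false]) or anticommutation ([true]). In an eigenbasis of [A], a
    nonzero entry (i, j) of [B] forces d_j = d_i or d_j = - d_i respectively, and the sign function,
    being odd, preserves that relation. *)
Lemma sgnmx_intertwine (b : bool) A B : adjmx A = A ->
  B *m A = (-1) ^+ b *: (A *m B) -> B *m sgnmx A = (-1) ^+ b *: (sgnmx A *m B).
Proof.
move=> /hermitian_spectral; rewrite /sgnmx.
set P := spectralmx A; set d := spectral_diag A => -[PP PP' dr AE] BA.
pose B' := P *m B *m adjmx P.
have BE : B = adjmx P *m B' *m P.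
  by rewrite /B' !mulmxA PP' mul1mx -mulmxA PP' mulmx1.
have simL (D : 'M[C]_n) : B *m (adjmx P *m D *m P) = adjmx P *m (B' *m D) *m P.
  by rewrite BE !mulmxA -(mulmxA _ P (adjmx P)) PP mulmx1.
have simR (D : 'M[C]_n) : (adjmx P *m D *m P) *m B = adjmx P *m (D *m B') *m P.
  by rewrite BE !mulmxA -(mulmxA _ P (adjmx P)) PP mulmx1.
have : B' *m diag_mx d = (-1) ^+ b *: (diag_mx d *m B').
  have : P *m (B *m A) *m adjmx P = P *m ((-1) ^+ b *: (A *m B)) *m adjmx P by rewrite BA.
  rewrite AE simL simR -scalemxAr -scalemxAl !mulmxA PP !mul1mx.
  by rewrite -!(mulmxA _ P (adjmx P)) PP !mulmx1.
rewrite simL simR => Bd; rewrite scalemxAl scalemxAr; congr (_ *m _ *m _).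
apply/matrixP => i j; move/matrixP/(_ i j): Bd.
move: B' {BE simL simR BA} => {}B; rewrite !mul_mx_diag !mul_diag_mx !mxE.
have [->|Bij_neq0] := eqVneq (B i j) 0; first by rewrite !(mulr0, mul0r).
rewrite !mulrA ![_ * B i j]mulrC => /(mulfI Bij_neq0) ->; congr (_ * _).
by case: b => //=; rewrite ?expr0 ?expr1 ?mulN1r ?mul1r ?real_sgN.
Qed.

Lemma sgnmx_sqr A : adjmx A = A -> (forall i, spectral_diag A 0 i != 0) ->
  sgnmx A * sgnmx A = 1.
Proof.
move=> /hermitian_spectral[PP PP' dr _] d_neq0; rewrite /sgnmx.
rewrite -[LHS]/(_ *m _) !mulmxA -(mulmxA _ (spectralmx A) (adjmx _)) PP mulmx1.
rewrite -(mulmxA (adjmx _)) mulmx_diag -[1]PP'; congr (_ *m _).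
rewrite -[RHS]mulmx1; congr (_ *m _); apply/matrixP => i j; rewrite !mxE.
by rewrite -expr2 sqr_sg d_neq0.
Qed.

End MatrixSign.

(** * Operator bounds *)

Section SpectralBound.
Variables (C : numClosedFieldType) (n : nat).
Implicit Types (A B P S T : 'M[C]_n) (a b c : C).

(** A bound on the operator norm stated without a supremum; matrices act on row vectors from the
    right. *)
Definition opbound A c := forall v : 'rV[C]_n, rnorm (v *m A) <= c * rnorm v.

Lemma opbound_weaken A a b : a <= b -> opbound A a -> opbound A b.
Proof.
by move=> ab Aa v; rewrite (le_trans (Aa v)) // ler_wpM2r // rnorm_ge0.
Qed.

Lemma opboundN A a : opbound A a -> opbound (- A) a.
Proof. by move=> Aa v; rewrite mulmxN rnormN. Qed.

Lemma opboundD A B a b : opbound A a -> opbound B b -> opbound (A + B) (a + b).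
Proof.
move=> Aa Bb v; rewrite mulmxDr (le_trans (rnorm_triangle _ _)) //.
by rewrite mulrDl lerD.
Qed.

Lemma opboundB A B a b : opbound A a -> opbound B b -> opbound (A - B) (a + b).
Proof. by move=> Aa Bb; apply/opboundD/opboundN. Qed.

Lemma opboundM A B a b : 0 <= b -> opbound A a -> opbound B b -> opbound (A * B) (a * b).
Proof.
move=> b0 Aa Bb v; rewrite -[A * B]/(A *m B) mulmxA (le_trans (Bb _)) //.
by rewrite [a * b]mulrC -mulrA ler_wpM2l.
Qed.

Lemma opbound_half A a : opbound A (2 * a) -> opbound (2^-1 *: A) a.
Proof.
move=> Aa v; rewrite -scalemxAr rnormZ ger0_norm ?invr_ge0 ?ler0n //.
by rewrite ler_pdivrMl ?ltr0n // mulrA.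
Qed.

Lemma opbound_reflection P : adjmx P = P -> P * P = 1 -> opbound P 1.
Proof.
move=> Ph PP v; rewrite mul1r /rnorm dotmx_isometry //.
by rewrite Ph; exact: PP.
Qed.

Lemma opbound_twirl P S a : 0 <= a -> opbound P 1 -> opbound S a ->
  opbound (twirl P S) a.
Proof.
move=> a0 Pb Sa; apply: opbound_half; rewrite mulr2n mulrDl mul1r.
apply: opboundD => //; rewrite -[a]mulr1; apply: opboundM => //.
by rewrite -[a]mul1r; apply: opboundM.
Qed.

(** S - PSP = [S, P] P, and the factor 1/2 of the twirl explains the [2 * a]. *)
Lemma opbound_sub_twirl P S a : opbound P 1 -> P * P = 1 ->
  opbound (S * P - P * S) (2 * a) -> opbound (S - twirl P S) a.
Proof.
move=> Pb PP Sa; have -> : S - twirl P S = 2^-1 *: ((S * P - P * S) * P).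
  by rewrite sub_twirl mulrBl -(mulrA S) PP mulr1.
by apply: opbound_half; rewrite -[2 * a]mulr1; apply: opboundM.
Qed.

Lemma opbound_eigenvalue A c (v : 'rV_n) z :
  opbound A c -> rnorm v = 1 -> v *m A = z *: v -> `|z| <= c.
Proof. by move=> Ac v1 Av; have := Ac v; rewrite Av rnormZ v1 !mulr1. Qed.

Lemma opbound_spectral P (d : 'rV_n) c : 0 <= c ->
  P *m adjmx P = 1%:M -> adjmx P *m P = 1%:M ->
  (forall i, `|d 0 i| <= c) -> opbound (adjmx P *m diag_mx d *m P) c.
Proof.
move=> c0 PP PP' dc v; rewrite -(@ler_pXn2r _ 2) // ?nnegrE ?mulr_ge0 ?rnorm_ge0 //.
rewrite exprMn /rnorm !sqrtCK !mulmxA dotmx_isometry //.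
rewrite -(dotmx_isometry v (P := adjmx P)); last by rewrite adjmxK.
move: (v *m adjmx P) => {}v; rewrite !dotmx_sum mulr_sumr; apply: ler_sum => i _.
rewrite mul_mx_diag mxE normrM exprMn mulrC ler_wpM2r ?exprn_ge0 ?normr_ge0 //.
by rewrite ler_pXn2r // ?nnegrE ?normr_ge0.
Qed.

(** For nonzero x, x^2 - 1 is x - sg x times a factor of modulus |x| + 1 >= 1; at 0 the left side
    vanishes. *)
Lemma sg_approx (x : C) : x \is Num.real -> `|Num.sg x - x| <= `|x ^+ 2 - 1|.
Proof.
move=> xr; have [->|x0] := eqVneq x 0.
  by rewrite sgr0 subrr normr0.
have s2 : Num.sg x ^+ 2 = 1 by rewrite sqr_sg x0.
have xE : x = Num.sg x * `|x| by exact: realEsg.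
have -> : x ^+ 2 - 1 = (x - Num.sg x) * (Num.sg x * (`|x| + 1)).
  by rewrite mulrDr mulr1 -xE -subr_sqr s2.
rewrite distrC normrM ler_peMr // normrM normr_sg x0 mul1r ger0_norm ?addr_ge0 //.
by rewrite lerDr.
Qed.

Lemma spectral_diag_approx A c i : adjmx A = A -> opbound (A * A - 1) c ->
  `|spectral_diag A 0 i ^+ 2 - 1| <= c.
Proof.
move=> /hermitian_spectral[PP PP' dr AE] Ac.
have vA := spectral_eigenvalue (spectral_diag A) i PP; rewrite -AE in vA.
apply: (opbound_eigenvalue Ac (v := delta_mx 0 i *m spectralmx A)).
  by rewrite /rnorm dotmx_isometry // dotmx_delta sqrtC1.
rewrite mulmxBr mulmx1 -[A * A]/(A *m A) mulmxA vA -scalemxAl vA scalerA.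
by rewrite scalerBl scale1r expr2.
Qed.

Lemma opbound_sgnmx A c : adjmx A = A -> 0 <= c -> opbound (A * A - 1) c ->
  opbound (sgnmx A - A) c.
Proof.
move=> Ah c0 Ac; have [PP PP' dr AE] := hermitian_spectral Ah.
rewrite {2}AE /sgnmx -mulmxBl -mulmxBr -raddfB.
apply: opbound_spectral => // i; rewrite !mxE.
by apply: le_trans (sg_approx (dr i)) _; apply: spectral_diag_approx.
Qed.

(** A zero eigenvalue would give [A * A - 1] the eigenvalue -1, which [c < 1] excludes. *)
Lemma sgnmx_involution A c : adjmx A = A -> c < 1 -> opbound (A * A - 1) c ->
  sgnmx A * sgnmx A = 1.
Proof.
move=> Ah c1 Ac; apply: sgnmx_sqr => // i; apply/eqP => di0.
have := spectral_diag_approx i Ah Ac.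
rewrite di0 expr0n sub0r normrN1 => /le_lt_trans/(_ c1).
by rewrite ltxx.
Qed.

End SpectralBound.

(** * Rounding to exact qubits *)

Section Qubits.
Variables (C : numClosedFieldType) (n : nat).
Implicit Types (A B P S T : 'M[C]_n) (Q : bool -> 'M[C]_n) (a e : C).

(* [Q true] plays the role of X and [Q false] that of Z. *)
Definition mxqubit Q :=
  [/\ forall b, adjmx (Q b) = Q b, forall b, Q b * Q b = 1 &
      Q true * Q false = - (Q false * Q true)].

Lemma opbound_qubit Q b : mxqubit Q -> opbound (Q b) 1.
Proof. by case=> Qh QQ _; apply: opbound_reflection. Qed.

Lemma antitwirl_anticomm P S : P * P = 1 ->
  P * (S - twirl P S) = - ((S - twirl P S) * P).
Proof.
move=> PP; rewrite sub_twirl mulmx_scaler mulmx_scalel -scalerN; congr (_ *: _).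
by rewrite mulrBr mulrBl opprB !mulrA PP mul1r -[_ * P * P]mulrA PP mulr1.
Qed.

Lemma opbound_antitwirl P S a : 0 <= a -> opbound P 1 -> opbound S a ->
  opbound (S - twirl P S) a.
Proof.
move=> a0 Pb Sa; rewrite sub_twirl; apply: opbound_half; rewrite mulr2n mulrDl mul1r.
apply: opboundB => //; rewrite -[a]mulr1; apply: opboundM => //.
by rewrite -[a]mul1r; apply: opboundM.
Qed.

(** The right side is the part of [S, T] that anticommutes with [P], whose norm is at most that of
    [S, T]. So after twirling by X the commutator bound with Z is not degraded. *)
Lemma commutator_twirl P S T : P * P = 1 -> T * P = - (P * T) ->
  twirl P S * T - T * twirl P S = (S * T - T * S) - twirl P (S * T - T * S).
Proof.
move=> PP TP; rewrite sub_twirl /twirl mulmx_scalel mulmx_scaler -scalerBr.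
congr (_ *: _); rewrite mulrDl mulrDr opprD addrACA; congr (_ + _).
rewrite mulrBr mulrBl opprB [RHS]addrC !mulrA TP mulNr mulNr opprK.
have PT : P * T = - (T * P) by rewrite TP opprK.
by rewrite -(mulrA _ P T) PT mulrN !mulrA addrC.
Qed.

Definition double_twirl Q S := twirl (Q false) (twirl (Q true) S).

Lemma double_twirlB Q S T : double_twirl Q (S - T) = double_twirl Q S - double_twirl Q T.
Proof. by rewrite /double_twirl !twirlB. Qed.

Lemma double_twirlD Q S T : double_twirl Q (S + T) = double_twirl Q S + double_twirl Q T.
Proof. by rewrite /double_twirl !twirlD. Qed.

Lemma double_twirl0 Q : double_twirl Q 0 = 0.
Proof. by rewrite /double_twirl !twirl0. Qed.

Lemma double_twirl1 Q : mxqubit Q -> double_twirl Q 1 = 1.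
Proof. by case=> _ QQ _; rewrite /double_twirl !twirl1. Qed.

Lemma adjmx_double_twirl Q S : mxqubit Q -> adjmx S = S ->
  adjmx (double_twirl Q S) = double_twirl Q S.
Proof. by case=> Qh _ _ Sh; do !apply: adjmx_twirl. Qed.

Lemma opbound_double_twirl Q S a : mxqubit Q -> 0 <= a -> opbound S a ->
  opbound (double_twirl Q S) a.
Proof.
move=> Qq a0 Sa; apply: (opbound_twirl a0 (opbound_qubit _ Qq)).
exact: (opbound_twirl a0 (opbound_qubit _ Qq) Sa).
Qed.

Lemma comm_double_twirl Q b S : mxqubit Q -> GRing.comm (Q b) (double_twirl Q S).
Proof.
case=> _ QQ QA; case: b; last exact: twirl_comm.
by apply: anticomm_twirl => //; apply: twirl_comm.
Qed.

(** The defect telescopes into that of the Z twirl plus the Z twirl of the defect of the X twirl.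
    Each is a product of two twirling errors of size [e], whence [2 * e ^+ 2]. *)
Lemma double_twirlM_defect Q S T e : mxqubit Q -> 0 <= e ->
  (forall b, opbound (S * Q b - Q b * S) (2 * e)) ->
  (forall b, opbound (T * Q b - Q b * T) (2 * e)) ->
  opbound (double_twirl Q S * double_twirl Q T - double_twirl Q (S * T)) (2 * e ^+ 2).
Proof.
move=> Qq e0 Sb Tb; have [Qh QQ QA] := Qq; have Qb b := opbound_qubit b Qq.
have e20 : 0 <= 2 * e by rewrite mulr_ge0 ?ler0n.
have ZX : Q false * Q true = - (Q true * Q false) by rewrite QA opprK.
have stepZ U : opbound (U * Q false - Q false * U) (2 * e) ->
    opbound (twirl (Q true) U - twirl (Q false) (twirl (Q true) U)) e.
  move=> Ub; apply: opbound_sub_twirl => //; rewrite commutator_twirl //.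
  exact: opbound_antitwirl.
rewrite -(subrKA (twirl (Q false) (twirl (Q true) S * twirl (Q true) T))).
rewrite -twirlB !twirlM_defect //.
have -> : 2 * e ^+ 2 = e * e + e * e by ring.
apply: opboundD; last apply: opbound_twirl => //; first 1 last.
- by rewrite mulr_ge0.
- by apply/opboundN/opboundM => //; apply: opbound_sub_twirl.
- by apply/opboundN/opboundM => //; apply: stepZ.
Qed.

(** Z is first replaced by its part anticommuting exactly with the rounded X; the sign, being odd,
    keeps the anticommutation. *)
Definition round_qubit Q : bool -> 'M[C]_n := fun b =>
  if b then sgnmx (Q true) else sgnmx (Q false - twirl (sgnmx (Q true)) (Q false)).

Lemma comm_sgnmx A B : adjmx A = A -> GRing.comm B A -> GRing.comm B (sgnmx A).
Proof.
move=> Ah BA; have := @sgnmx_intertwine _ _ false A B Ah.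
by rewrite expr0 !scale1r; apply.
Qed.

Lemma adjmx_antitwirl P S : adjmx P = P -> adjmx S = S ->
  adjmx (S - twirl P S) = S - twirl P S.
Proof. by move=> Ph Sh; rewrite adjmxD adjmxN adjmx_twirl ?Sh. Qed.

Lemma comm_round_qubit Q B b : (forall c, adjmx (Q c) = Q c) ->
  (forall c, GRing.comm B (Q c)) -> GRing.comm B (round_qubit Q b).
Proof.
move=> Qh BQ; have BX : GRing.comm B (sgnmx (Q true)) by exact: comm_sgnmx.
rewrite /round_qubit; case: b => //; apply: comm_sgnmx.
  by apply: adjmx_antitwirl => //; apply: adjmx_sgnmx.
by apply: commrB => //; apply: comm_twirl.
Qed.

(** Rounding X costs [a], so Z anticommutes with the new X up to 4a, and dropping half of this
    anticommutator moves Z by 2a. The square of the result is then within 2a + 2a + a = 5a of 1, so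
    its sign costs 5a more: 7a in total. *)
Lemma round_qubitP Q a : 0 <= a -> 5 * a < 1 ->
  (forall b, adjmx (Q b) = Q b) -> (forall b, opbound (Q b) 1) ->
  (forall b, opbound (Q b * Q b - 1) a) ->
  opbound (Q true * Q false + Q false * Q true) (2 * a) ->
  mxqubit (round_qubit Q) /\ forall b, opbound (round_qubit Q b - Q b) (7 * a).
Proof.
move=> a0 a5 Qh Qb Qsqr Qanti; set X := sgnmx (Q true).
have a1 : a < 1 by rewrite (le_lt_trans _ a5) // ler_peMl // ler1n.
have Xh : adjmx X = X by exact: adjmx_sgnmx.
have XX : X * X = 1 by apply: (sgnmx_involution _ a1 (Qsqr true)).
have Xb : opbound X 1 by exact: opbound_reflection.
have Xa : opbound (X - Q true) a by apply: opbound_sgnmx.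
set Z1 := Q false - twirl X (Q false).
have Z1h : adjmx Z1 = Z1 by apply: adjmx_antitwirl.
have Z1b : opbound Z1 1 by apply: opbound_antitwirl.
have Z1a : opbound (Z1 - Q false) (2 * a).
  have -> : Z1 - Q false = - (2^-1 *: ((Q false * X + X * Q false) * X)).
    by rewrite /Z1 addrAC subrr add0r mulrDl -mulrA XX mulr1.
  apply/opboundN/opbound_half; rewrite -[2 * (2 * a)]mulr1; apply: opboundM => //.
  have -> : Q false * X + X * Q false = Q false * (X - Q true) +
      ((X - Q true) * Q false + (Q true * Q false + Q false * Q true)).
    by rewrite mulrBr mulrBl !addrA subrK [RHS]addrAC subrK.
  have -> : 2 * (2 * a) = 1 * a + (a * 1 + 2 * a) by ring.
  by apply: opboundD; [|apply: (opboundD _ Qanti)]; apply: opboundM.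
have Z1sqr : opbound (Z1 * Z1 - 1) (5 * a).
  have -> : Z1 * Z1 - 1 = (Z1 - Q false) * Z1 + (Q false * (Z1 - Q false)
      + (Q false * Q false - 1)).
    by move: Z1 {Z1h Z1b Z1a} => U; rewrite mulrBl mulrBr !addrA !subrK.
  have -> : 5 * a = (2 * a) * 1 + (1 * (2 * a) + a) by ring.
  have a20 : 0 <= 2 * a by rewrite mulr_ge0 ?ler0n.
  by apply: opboundD; [|apply: (opboundD _ (Qsqr false))]; apply: opboundM.
have a50 : 0 <= 5 * a by rewrite mulr_ge0 ?ler0n.
have Za : opbound (sgnmx Z1 - Z1) (5 * a) by apply: opbound_sgnmx.
split; last first.
  case; first by apply: (opbound_weaken _ Xa); rewrite ler_peMl // ler1n.
  rewrite -[round_qubit Q false]/(sgnmx Z1) -[X in opbound X _](subrKA Z1).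
  have -> : 7 * a = 5 * a + 2 * a by ring.
  exact: (opboundD Za Z1a).
split.
- by case; [exact: Xh | exact: adjmx_sgnmx].
- by case; [exact: XX | exact: (sgnmx_involution _ a5 Z1sqr)].
- have := @sgnmx_intertwine _ _ true Z1 X Z1h.
  by rewrite expr1 !scaleN1r; apply; apply: antitwirl_anticomm.
Qed.

End Qubits.

(** * Successive exact commutation *)

Section Step.
Variables (C : numClosedFieldType) (n : nat).
Implicit Types (S T : 'M[C]_n) (P Q : bool -> 'M[C]_n) (a e : C).

Definition commute_qubit P Q : bool -> 'M[C]_n :=
  round_qubit (fun b => double_twirl P (Q b)).

(** The twirled pair satisfies the qubit relations up to the multiplicativity defect, so rounding
    applies with a = 2e^2; this gives the constants 10 and 14. *)
Lemma commute_qubitP P Q e : 0 <= e -> 10 * e ^+ 2 < 1 -> mxqubit P -> mxqubit Q ->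
  (forall b c, opbound (Q b * P c - P c * Q b) (2 * e)) ->
  [/\ mxqubit (commute_qubit P Q),
      forall b c, GRing.comm (P b) (commute_qubit P Q c) &
      forall b, opbound (commute_qubit P Q b - double_twirl P (Q b)) (14 * e ^+ 2)].
Proof.
move=> e0 e_small Pq Qq QP; have [Qh QQ QA] := Qq.
have e20 : 0 <= e ^+ 2 by rewrite exprn_ge0.
have defect b c := double_twirlM_defect Pq e0 (QP b) (QP c).
have adj_dt b : adjmx (double_twirl P (Q b)) = double_twirl P (Q b).
  exact: adjmx_double_twirl.
have [||||||roundq round_close] :=
  @round_qubitP _ _ (fun b => double_twirl P (Q b)) (2 * e ^+ 2).
- by rewrite mulr_ge0 ?ler0n.
- by have -> : 5 * (2 * e ^+ 2) = 10 * e ^+ 2 by ring.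
- exact: adj_dt.
- by move=> b; apply: opbound_double_twirl Pq _ (opbound_qubit _ Qq).
- by move=> b; have := defect b b; rewrite QQ double_twirl1.
(* The subtracted 0 is written as the double twirl of the vanishing anticommutator, making the goal
   a sum of two defects. *)
- rewrite mulr2n mulrDl mul1r -[X in opbound X _]subr0 -(double_twirl0 P).
  have -> : 0 = Q true * Q false + Q false * Q true by rewrite QA addNr.
  by rewrite double_twirlD opprD addrACA; apply: opboundD.
split=> // [b c|b].
  by apply: comm_round_qubit => // {}c; apply: comm_double_twirl.
have -> : 14 * e ^+ 2 = 7 * (2 * e ^+ 2) by ring.
exact: round_close.
Qed.

(** Exact commutation obtained in earlier rounds survives later ones. *)
Lemma comm_commute_qubit P Q S c : mxqubit P -> mxqubit Q ->
  (forall b, GRing.comm S (P b)) -> (forall b, GRing.comm S (Q b)) ->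
  GRing.comm S (commute_qubit P Q c).
Proof.
move=> Pq [Qh _ _] SP SQ; apply: comm_round_qubit => b.
  exact: adjmx_double_twirl.
by do 2!apply: comm_twirl => //.
Qed.

Lemma commutator_perturb S S' T T' a c : opbound S 1 -> opbound T 1 ->
  opbound S' 1 -> opbound T' 1 -> 0 <= a ->
  opbound (S' - S) a -> opbound (T' - T) a -> opbound (S * T - T * S) c ->
  opbound (S' * T' - T' * S') (c + 4 * a).
Proof.
move=> S1 T1 S'1 T'1 a0 Sa Ta STc.
have -> : S' * T' - T' * S' = (S * T - T * S) +
    (((S' - S) * T' + S * (T' - T)) - ((T' - T) * S' + T * (S' - S))).
  rewrite !mulrBl !mulrBr !subrKA opprB.
  move: (S * T) (T * S) (S' * T') (T' * S') => x y z t.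
  by apply/matrixP => i j; rewrite !mxE; ring.
have -> : c + 4 * a = c + ((a * 1 + 1 * a) + (a * 1 + 1 * a)) by ring.
by apply: opboundD => //; apply: opboundB; apply: opboundD; apply: opboundM.
Qed.

(** The double twirl is a contraction, so the first-order term 2e does not grow. Two
    multiplicativity defects add 4e^2 and the rounding errors add 4 * 14e^2, in all 2 * 30e^2. *)
Lemma commute_qubit_commutator P Q Q' e b c : 0 <= e -> 10 * e ^+ 2 < 1 ->
  mxqubit P -> mxqubit Q -> mxqubit Q' ->
  (forall b c, opbound (Q b * P c - P c * Q b) (2 * e)) ->
  (forall b c, opbound (Q' b * P c - P c * Q' b) (2 * e)) ->
  opbound (Q b * Q' c - Q' c * Q b) (2 * e) ->
  opbound (commute_qubit P Q b * commute_qubit P Q' c -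
           commute_qubit P Q' c * commute_qubit P Q b) (2 * (e + 30 * e ^+ 2)).
Proof.
move=> e0 e_small Pq Qq Q'q QP Q'P QQ'.
have [Rq _ Ra] := commute_qubitP e0 e_small Pq Qq QP.
have [R'q _ R'a] := commute_qubitP e0 e_small Pq Q'q Q'P.
have -> : 2 * (e + 30 * e ^+ 2) =
  (2 * e ^+ 2 + (2 * e ^+ 2 + 2 * e)) + 4 * (14 * e ^+ 2) by ring.
have e20 : 0 <= 2 * e by rewrite mulr_ge0 ?ler0n.
apply: (commutator_perturb
  (S := double_twirl P (Q b)) (T := double_twirl P (Q' c))) => //.
- by apply: opbound_double_twirl Pq _ (opbound_qubit _ Qq).
- by apply: opbound_double_twirl Pq _ (opbound_qubit _ Q'q).
- exact: opbound_qubit.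
- exact: opbound_qubit.
- by rewrite mulr_ge0 ?ler0n ?exprn_ge0.
have D1 := double_twirlM_defect Pq e0 (QP b) (Q'P c).
have D2 := double_twirlM_defect Pq e0 (Q'P c) (QP b).
have D3 := opbound_double_twirl Pq e20 QQ'; rewrite double_twirlB in D3.
have := opboundD D1 (opboundD (opboundN D2) D3).
move: (double_twirl P (Q b) * _) (double_twirl P (Q' c) * _) => A B.
rewrite opprB; suff -> : forall x y : 'M[C]_n, A - x + (y - B + (x - y)) = A - B by [].
by move=> x y; apply/matrixP => i j; rewrite !mxE; ring.
Qed.

(** [k] counts the qubits already commuting exactly with all others. [e] is half the commutator
    bound, the size of a twirling error. Values of [Q] from [m] on are irrelevant. *)
Definition partially_commuting (m k : nat) e (Q : nat -> bool -> 'M[C]_n) :=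
  [/\ forall i, (i < m)%N -> mxqubit (Q i),
      forall i j b c, (i < k)%N -> (i < m)%N -> (j < m)%N -> i != j ->
        GRing.comm (Q i b) (Q j c) &
      forall i j b c, (i < m)%N -> (j < m)%N -> i != j ->
        opbound (Q i b * Q j c - Q j c * Q i b) (2 * e)].

Lemma opbound0 a : 0 <= a -> opbound (0 : 'M[C]_n) a.
Proof. by move=> a0 v; rewrite mulmx0 /rnorm linear0l sqrtC0 mulr_ge0 ?rnorm_ge0. Qed.

(** Qubit [k] is the pivot: it and its predecessors are kept, and every later qubit is made to
    commute with it. Each predecessor commutes with the pivot and with the old later qubit, hence
    with the new one. *)
Lemma partially_commuting_step m k e (Q : nat -> bool -> 'M[C]_n) :
  0 <= e -> 10 * e ^+ 2 < 1 -> (k < m)%N ->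
  partially_commuting m k e Q ->
  exists Q' : nat -> bool -> 'M[C]_n, partially_commuting m k.+1 (e + 30 * e ^+ 2) Q'.
Proof.
move=> e0 e_small km [Qq Qc Qe].
have ee : e <= e + 30 * e ^+ 2 by rewrite lerDl mulr_ge0 ?ler0n ?exprn_ge0.
pose Q' i := if (i <= k)%N then Q i else commute_qubit (Q k) (Q i).
have Qk i b c : (k < i)%N -> (i < m)%N ->
    opbound (Q i b * Q k c - Q k c * Q i b) (2 * e).
  by move=> ki im; apply: Qe => //; rewrite gtn_eqF.
have newP i (ki : (k < i)%N) (im : (i < m)%N) :=
  commute_qubitP e0 e_small (Qq k km) (Qq i im) (fun b c => Qk i b c ki im).
have comm_low i j b c : (i <= k)%N -> (j < m)%N -> i != j ->
    GRing.comm (Q' i b) (Q' j c).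
  move=> ik jm ij; have im := leq_ltn_trans ik km.
  rewrite /Q' ik; case: leqP => [jk|kj].
    have [ik'|ki] := ltnP i k; first exact: Qc.
    apply/esym/Qc => //; last by rewrite eq_sym.
    by rewrite ltn_neqAle jk andbT; apply: contraNneq ij => ->; rewrite eqn_leq ik ki.
  have [->|ik'] := eqVneq i k; first by have [_ + _] := newP j kj jm; apply.
  have {}ik : (i < k)%N by rewrite ltn_neqAle ik'.
  by apply: comm_commute_qubit (Qq k km) (Qq j jm) _ _ => d; apply: Qc.
exists Q'; split=> [i im|i j b c|i j b c im jm ij].
- by rewrite /Q'; case: leqP => [_|ki]; [exact: Qq | have [] := newP i ki im].
- by rewrite ltnS => ik im; apply: comm_low.
have e'0 : 0 <= 2 * (e + 30 * e ^+ 2) by rewrite mulr_ge0 ?ler0n // (le_trans e0).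
have [ik|ki] := leqP i k.
  by rewrite (comm_low i j b c ik jm ij) subrr; apply: opbound0.
have [jk|kj] := leqP j k.
  rewrite eq_sym in ij.
  by rewrite (comm_low j i c b jk im ij) subrr; apply: opbound0.
rewrite /Q' leqNgt ki leqNgt kj /=.
apply: commute_qubit_commutator (Qq k km) (Qq i im) (Qq j jm) _ _ _ => //.
- by move=> b' c'; apply: Qk.
- by move=> b' c'; apply: Qk.
- exact: Qe.
Qed.

(** After clearing denominators this is (x + 30)(x - 30) <= x^2. *)
Lemma inverse_step (x : nat) : (30 < x)%N ->
  (x%:R : C)^-1 + 30 * x%:R^-1 ^+ 2 <= ((x - 30)%:R)^-1.
Proof.
move=> x30; have x0 : 0 < (x%:R : C) by rewrite ltr0n; lia.
have y0 : 0 < ((x - 30)%:R : C) by rewrite ltr0n subn_gt0.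
have -> : (x%:R : C)^-1 + 30 * x%:R^-1 ^+ 2 = (x + 30)%:R / x%:R ^+ 2.
  by rewrite natrD; field; rewrite gt_eqF.
rewrite ler_pdivrMr ?exprn_gt0 // ler_pdivlMl // -natrX -natrM ler_nat.
nia.
Qed.

(** For N + 1 qubits N rounds suffice, as the last qubit has no successor to adjust. *)
Lemma exists_commuting_qubits N (Q : nat -> bool -> 'M[C]_n) : (0 < N)%N ->
  partially_commuting N.+1 0 (128 * N)%:R^-1 Q ->
  exists Q' : nat -> bool -> 'M[C]_n,
    partially_commuting N.+1 N (128 * N - 30 * N)%:R^-1 Q'.
Proof.
move=> N0 Q0.
suff H k : (k <= N)%N ->
    exists Q' : nat -> bool -> 'M[C]_n,
      partially_commuting N.+1 k (128 * N - 30 * k)%:R^-1 Q' by exact: H.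
elim: k => [|k IH] kN; first by exists Q; rewrite muln0 subn0.
have [Q1 Q1P] := IH (ltnW kN); set x := (128 * N - 30 * k)%N in Q1P.
(* Since k < N, x is at least 98 N + 30, so no natural subtraction truncates. *)
have x30 : (30 < x)%N by rewrite /x; lia.
have x_inv_ge0 : 0 <= (x%:R : C)^-1 by rewrite invr_ge0 ler0n.
have [||Q2 [Q2q Q2c Q2e]] := partially_commuting_step x_inv_ge0 _ _ Q1P.
- rewrite exprVn -natrX ltr_pdivrMr ?ltr0n ?expn_gt0 ?mul1r ?ltr_nat; nia.
- by rewrite (leq_trans kN).
exists Q2; split=> // i j b c im jm ij; apply: opbound_weaken (Q2e i j b c im jm ij).
rewrite ler_pM2l ?ltr0n // (le_trans (inverse_step x30)) //.
by have -> : (128 * N - 30 * k.+1 = x - 30)%N by rewrite /x; lia.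
Qed.

End Step.

(** * Counting dimensions *)

(** In a full-rank factorization e = c r, idempotence cancels to r c = 1 of size the rank, and the
    trace is cyclic. *)
Lemma mxtrace_idempotent (F : fieldType) n (e : 'M[F]_n) :
  e *m e = e -> \tr e = (\rank e)%:R.
Proof.
move: (col_base e) (row_base e) (col_base_full e) (row_base_free e) (mulmx_base e).
move=> c r c_full r_free cr ee.
have rc : r *m c = 1%:M.
  apply: (row_full_inj c_full); apply: (row_free_inj r_free) => /=.
  by rewrite mulmx1 !mulmxA cr -mulmxA cr.
by rewrite -{1}cr mxtrace_mulC rc mxtrace1.
Qed.

Section Counting.
Variables (C : numClosedFieldType) (n m : nat) (Q : nat -> bool -> 'M[C]_n).
Hypothesis Qq : forall i, (i < m)%N -> mxqubit (Q i).
Hypothesis Qc : forall i j b c, (i < m)%N -> (j < m)%N -> i != j ->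
  GRing.comm (Q i b) (Q j c).

(** The projection onto the common +1 eigenspace of the first [k] operators Z. *)
Fixpoint joint_projection k : 'M[C]_n :=
  if k is j.+1 then joint_projection j * (2^-1 *: (1 + Q j false)) else 1.

Lemma comm_joint_projection k j b : (k <= j)%N -> (j < m)%N ->
  GRing.comm (Q j b) (joint_projection k).
Proof.
elim: k => [|k IH] kj jm; first exact: commr1.
apply: commrM; first exact/IH/jm/ltnW.
apply: commr_scalemx; apply: commrD; first exact: commr1.
by apply: Qc => //; [exact: ltn_trans jm | rewrite gtn_eqF].
Qed.

Lemma joint_projection_idem k : (k <= m)%N ->
  joint_projection k * joint_projection k = joint_projection k.
Proof.
elim: k => [|k IH] km /=; first by rewrite mulr1.
have [_ ZZ _] := Qq km; set p := 2^-1 *: (1 + Q k false).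
have pp : p * p = p.
  rewrite mulmx_scalel mulmx_scaler mulrDl mulrDr mulrDr !mul1r mulr1 ZZ.
  by rewrite [Q k false + 1]addrC matrix_halfD.
have pe : GRing.comm (joint_projection k) p.
  apply: commr_scalemx; apply: commrD; first exact: commr1.
  exact/esym/comm_joint_projection.
by rewrite {1}pe -mulrA [_ * (_ * p)]mulrA IH ?(ltnW km) // pe mulrA pp.
Qed.

(** Each factor halves the trace: X_k commutes with the previous projection e and anticommutes with
    Z_k, so conjugation by X_k negates e Z_k, whose trace is therefore 0. *)
Lemma mxtrace_joint_projection k : (k <= m)%N ->
  \tr (joint_projection k) * (2 ^ k)%:R = n%:R.
Proof.
elim: k => [|k IH] km /=; first by rewrite expn0 mulr1 mxtrace1.
rewrite mulmx_scaler mxtraceZ mulrDr mulr1 mxtraceD.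
set e := joint_projection k; have [_ XX XZ] := Qq km.
have eX : GRing.comm (Q k true) e by exact: comm_joint_projection.
have eZ0 : \tr (e * Q k false) = 0.
  apply/eqP; rewrite -eqNr; apply/eqP.
  have eZX : Q k true * (e * Q k false) * Q k true = - (e * Q k false).
    rewrite mulrA eX -(mulrA e) XZ mulrN mulNr !mulrA.
    by rewrite -(mulrA _ (Q k true)) XX mulr1.
  have <- : \tr (- (e * Q k false)) = - \tr (e * Q k false) by rewrite linearN.
  by rewrite -eZX [LHS]mxtrace_mulC -[_ *m _]/(Q k true * _) mulrA XX mul1r.
rewrite eZ0 addr0 expnS natrM mulrACA mulVf ?mul1r ?pnatr_eq0 //.
by apply: IH; apply: ltnW.
Qed.

Lemma dvdn_commuting_qubits : (2 ^ m %| n)%N.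
Proof.
have := mxtrace_joint_projection (leqnn m).
rewrite mxtrace_idempotent; last exact: joint_projection_idem.
by rewrite -natrM => /eqP; rewrite eqr_nat => /eqP <-; apply: dvdn_mull.
Qed.

End Counting.

(** * Passage from operators to matrices *)

Local Open Scope complex_scope.

Section HilbertNorm.
Variables (R : realType) (H : vectType R[i]) (dot : {dot H for Num.conj}).
Implicit Types (u v : H) (A B : 'End(H)).

Lemma dotE v : dot v v = (hnorm dot v ^+ 2)%:C.
Proof.
have := dnorm_ge0 dot v; rewrite /hnorm lecE /= => /andP[/eqP Im0 Re0].
by rewrite sqr_sqrtr //; case: (dot v v) Im0 Re0 => a b /= -> _.
Qed.

Lemma hnorm_ge0 v : 0 <= hnorm dot v.
Proof. exact: sqrtr_ge0. Qed.

Lemma hnormE v : (hnorm dot v)%:C = sqrtC (dot v v).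
Proof. by rewrite dotE rmorphXn /= sqrCK // ler0c hnorm_ge0. Qed.

Lemma hnorm_triangle u v : hnorm dot (u + v) <= hnorm dot u + hnorm dot v.
Proof. by rewrite -lecR rmorphD /= !hnormE triangle_lerif. Qed.

Lemma hnorm_opp v : hnorm dot (- v) = hnorm dot v.
Proof. by rewrite /hnorm hnormN. Qed.

Lemma hnorm0 : hnorm dot 0 = 0.
Proof. by rewrite /hnorm linear0l sqrtr0. Qed.

Lemma hnorm_eq0 v : hnorm dot v = 0 -> v = 0.
Proof. by move=> v0; apply/eqP; rewrite -(dnorm_eq0 dot) dotE v0 expr0n. Qed.

Lemma hnormZ (a : R) v : 0 <= a -> hnorm dot (a%:C *: v) = a * hnorm dot v.
Proof.
move=> a0; apply: (@complexI R); rewrite rmorphM /= !hnormE dnormZ.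
rewrite sqrtCM ?nnegrE ?exprn_ge0 ?dnorm_ge0 // ?normr_ge0 //.
by rewrite sqrCK ?normr_ge0 // ger0_norm // ler0c.
Qed.

Lemma reflection_hnorm A v : reflection dot A -> hnorm dot (A v) = hnorm dot v.
Proof. by case=> hA A2; rewrite /hnorm hA -comp_lfunE A2 id_lfunE. Qed.

(** The a priori bound [K] only serves to make the supremum genuine; its value does not enter the
    conclusion. *)
Lemma le_opnorm A (K : R) v :
  (forall w, hnorm dot (A w) <= K * hnorm dot w) ->
  hnorm dot (A v) <= opnorm dot A * hnorm dot v.
Proof.
move=> AK; have [v0|v_neq0] := eqVneq (hnorm dot v) 0.
  by rewrite (hnorm_eq0 v0) linear0 !hnorm0 mulr0.
have v_gt0 : 0 < hnorm dot v by rewrite lt_def v_neq0 hnorm_ge0.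
rewrite -ler_pdivrMr // mulrC -hnormZ ?invr_ge0 ?hnorm_ge0 // -linearZ /=.
apply: ub_le_sup; last first.
  exists ((hnorm dot v)^-1%:C *: v) => //=.
  by rewrite hnormZ ?invr_ge0 ?hnorm_ge0 // mulVf.
exists `|K| => _ [w /= w1 <-]; apply: le_trans (AK w) _.
rewrite (le_trans (ler_norm _)) // normrM (ger0_norm (hnorm_ge0 w)).
by rewrite ler_piMr.
Qed.

Lemma commutator_bound A B (c : R) v :
  reflection dot A -> reflection dot B -> opnorm dot (commutator A B) <= c ->
  hnorm dot (commutator A B v) <= c * hnorm dot v.
Proof.
move=> rA rB ABc; apply: (@le_trans _ _ (opnorm dot (commutator A B) * hnorm dot v)).
  (* Reflections are isometries, so 2 bounds any commutator of two of them. *)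
  apply: (le_opnorm (K := 2)) => w; rewrite /commutator add_lfunE opp_lfunE !comp_lfunE.
  apply: le_trans (hnorm_triangle _ _) _; rewrite hnorm_opp !reflection_hnorm //.
  by rewrite mulr2n mulrDl mul1r.
by rewrite ler_wpM2r ?hnorm_ge0.
Qed.

(** [T] comes from factoring the Gram matrix of the basis underlying [v2r]. *)
Lemma orthonormal_coordinates :
  exists2 T : 'M[R[i]]_(dim H), T \in unitmx &
    forall u v, dot u v = dotmx (v2r u *m T) (v2r v *m T).
Proof.
pose b i : H := r2v (delta_mx 0 i).
pose G : 'M[R[i]]_(dim H) := \matrix_(i, j) dot (b i) (b j).
have dotG u v : dot u v = dotmx (v2r u *m G) (v2r v).
  rewrite -{1}(v2rK u) -{1}(v2rK v) {1}[v2r u]row_sum_delta {1}[v2r v]row_sum_delta.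
  rewrite dotmx_adjE mxE !linear_sum /=; apply: eq_bigr => j _.
  rewrite linear_sumlz adjmxE !mxE mulr_suml; apply: eq_bigr => i _.
  by rewrite !linearZ /= linearZl_LR /= [LHS]mulrC mxE.
have [||T Tu GE] := @gram_factorization _ _ G.
- by apply/matrixP => i j; rewrite adjmxE !mxE [RHS]hermC expr0 mul1r.
- move=> x x_neq0; rewrite -(r2vK x) -dotG dnorm_gt0; apply: contraNneq x_neq0.
  by move=> /(congr1 v2r); rewrite r2vK linear0 => ->.
- by exists T => // u v; rewrite dotG GE mulmxA dotmx_mull adjmxK.
Qed.

End HilbertNorm.

Section MatrixModel.
Variables (R : realType) (H : vectType R[i]) (dot : {dot H for Num.conj}).

Lemma matrix_model : exists (phi : {linear H -> 'rV[R[i]]_(dim H)})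
    (M : 'End(H) -> 'M[R[i]]_(dim H)),
  [/\ forall x, exists v, phi v = x, forall (A : 'End(H)) v, phi (A v) = phi v *m M A &
      forall u v, dot u v = dotmx (phi u) (phi v)].
Proof.
have [T Tu dotT] := orthonormal_coordinates dot.
exists (mulmxr T \o v2r), (fun A => invmx T *m f2mx A *m T); split=> [x|A v|//].
  by exists (r2v (x *m invmx T)); rewrite /= r2vK mulmxKV.
by rewrite /= !mulmxA mulmxK // unlock /= r2vK.
Qed.

End MatrixModel.

Section QubitsInMatrixModel.
Variables (R : realType) (H : vectType R[i]) (dot : {dot H for Num.conj}).
Variables (phi : {linear H -> 'rV[R[i]]_(dim H)}) (M : 'End(H) -> 'M[R[i]]_(dim H)).
Hypothesis phi_surj : forall x, exists v, phi v = x.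
Hypothesis phiM : forall (A : 'End(H)) v, phi (A v) = phi v *m M A.
Hypothesis phi_dot : forall u v, dot u v = dotmx (phi u) (phi v).
Implicit Types A B : 'End(H).

Lemma matrix_model_ext (P S : 'M[R[i]]_(dim H)) :
  (forall v, phi v *m P = phi v *m S) -> P = S.
Proof.
move=> PS; apply/row_matrixP => k; rewrite !rowE.
by have [v <-] := phi_surj (delta_mx 0 k); apply: PS.
Qed.

Lemma rnorm_phi v : rnorm (phi v) = (hnorm dot v)%:C.
Proof. by rewrite hnormE phi_dot. Qed.

Lemma matrix_model_qubit X Z : qubit dot X Z ->
  mxqubit (fun b : bool => M (if b then X else Z)).
Proof.
case=> -[Xh XX] [Zh ZZ] XZ.
have adjM A : hermitian_op dot A -> adjmx (M A) = M A.
  move=> Ah; apply/esym/dotmx_extensional => x y.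
  have [u <-] := phi_surj x; have [v <-] := phi_surj y.
  by rewrite [RHS]dotmx_mull adjmxK -!phiM -!phi_dot Ah.
have sqrM A : (A \o A)%VF = \1%VF -> M A * M A = 1.
  move=> AA; apply: matrix_model_ext => v.
  by rewrite -[_ * _]/(_ *m _) mulmxA -!phiM -comp_lfunE AA id_lfunE mulmx1.
split=> [[]|[]|]; [exact: adjM | exact: adjM | exact: sqrM | exact: sqrM |].
apply/eqP; rewrite -addr_eq0; apply/eqP; apply: matrix_model_ext => v.
rewrite mulmxDr mulmx0 -![M _ * M _]/(_ *m _) !mulmxA -!phiM -linearD addrC.
by rewrite -!comp_lfunE -add_lfunE XZ lfunE linear0.
Qed.

(* Matrices act on row vectors from the right, so [M] reverses products. *)
Lemma matrix_model_commutator A B (c : R) :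
  reflection dot A -> reflection dot B -> opnorm dot (commutator B A) <= c ->
  opbound (M A * M B - M B * M A) c%:C.
Proof.
move=> rA rB BAc x; have [v <-] := phi_surj x.
have -> : phi v *m (M A * M B - M B * M A) = phi (commutator B A v).
  rewrite mulmxBr -![M _ * M _]/(_ *m _) !mulmxA -!phiM -linearB.
  by rewrite /commutator add_lfunE opp_lfunE !comp_lfunE.
by rewrite !rnorm_phi -rmorphM lecR; apply: commutator_bound.
Qed.

End QubitsInMatrixModel.

(** * The bound on the number of qubits *)

Unset Implicit Arguments.

Theorem corollary3p7 (R : realType) (n : nat) (eps : R)
    (n_ge1 : (1 <= n)%N)
    (eps_ge0 : 0 <= eps) (eps_lt1 : eps < 1)
    (eps_small : eps / (1 - eps) ^+ 2 <= 1 / (64%:R * n%:R))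
    (H : vectType R[i]) (dot : {dot H for Num.conj})
    (dimH : \dim {:H} = (2 ^ n)%N)
    (m : nat) (X Z : 'I_m -> 'End(H))
    (XZ_qubit : forall i : 'I_m, qubit dot (X i) (Z i))
    (almost_commute : forall i j : 'I_m, i != j ->
       forall S T : 'I_m -> 'End(H),
         S = X \/ S = Z -> T = X \/ T = Z ->
         opnorm dot (commutator (S i) (T j)) <= eps) :
  (m <= n)%N.
Proof.
(* As (1 - eps)^2 <= 1, the hypothesis gives eps <= 1/(64 n), that is 2e with e = 1/(128 n). *)
have eps_le : eps <= 2 * ((128 * n)%:R)^-1.
  have -> : 2 * ((128 * n)%:R : R)^-1 = 1 / (64%:R * n%:R).
    by rewrite natrM; field; rewrite pnatr_eq0 -lt0n.
  apply: le_trans eps_small; rewrite ler_pdivlMr ?exprn_gt0 ?subr_gt0 //.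
  by rewrite ler_piMr // exprn_ile1 //; lra.
rewrite leqNgt; apply/negP; case: m => // m in X Z XZ_qubit almost_commute * => nm.
have [phi [M [phi_surj phiM phi_dot]]] := matrix_model dot.
pose op (b : bool) : 'I_m.+1 -> 'End(H) := if b then X else Z.
(* Only the first n + 1 qubits are used; [inord] keeps their indices because n < m. *)
pose Q (i : nat) (b : bool) := M (if b then X (inord i) else Z (inord i)).
have Q0 : partially_commuting n.+1 0 ((128 * n)%:R)^-1 Q.
  split=> // [i _|i j b c im jm ij].
    exact: (matrix_model_qubit phi_surj phiM phi_dot (XZ_qubit _)).
  have QE k d : Q k d = M (op d (inord k)) by rewrite /Q /op; case: d.
  have op_refl d k : reflection dot (op d k).
    by have [] := XZ_qubit k; rewrite /op; case: d.
  have op_cases d : op d = X \/ op d = Z by rewrite /op; case: d; [left | right].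
  (* The indices are swapped because [M] reverses products. *)
  have ji : inord j != inord i :> 'I_m.+1.
    apply: contraNneq ij => /(congr1 val) /=.
    by rewrite !inordK ?(leq_trans _ nm) // => ->.
  rewrite !QE; apply: opbound_weaken (matrix_model_commutator phi_surj phiM phi_dot
    (op_refl b _) (op_refl c _) (almost_commute _ _ ji _ _ (op_cases c) (op_cases b))).
  by move: eps_le; rewrite -lecR rmorphM fmorphV /= !rmorph_nat.
have [Q' [Q'q Q'c _]] := exists_commuting_qubits n_ge1 Q0.
have : (2 ^ n.+1 %| dim H)%N.
  apply: dvdn_commuting_qubits Q'q _ => i j b c im jm ij.
  (* Of two distinct indices below n + 1, at least one is below n, so all pairs commute exactly. *)
  have [ni|ni] := ltnP i n; first exact: Q'c.
  have [nj|nj] := ltnP j n; first by apply/esym/Q'c; rewrite // eq_sym.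
  by exfalso; move/eqP: ij; lia.
by rewrite -dimvf dimH dvdn_Pexp2l // ltnn.
Qed.
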